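(* Let $k\ge 2$ be an integer and let $a,b,c,d$ be non-negative integers with $a+b=c+d=S\ge 2$ and $\{a,b\}\ne\{c,d\}$. Then \[ \bigl|a^k+b^k-c^k-d^k\bigr|\ \ge\ k(k-1)\,\lfloor S/2\rfloor^{k-2}\ \ge\ C_k\,S^{k-2},\qquad C_k=k(k-1)\,3^{2-k}. \] *)

(* Defs.v *)
From mathcomp Require Export all_boot all_order all_algebra finmap.
Local Open Scope ring_scope.

Definition C_ (k : nat) : rat := k%:R * (k%:R - 1) * 3%:R ^ (2%:Z - k%:Z).

(* Main.v *)
Require Import Defs.
From mathcomp Require Import all_boot all_order all_algebra finmap.
From mathcomp Require Import zify ring lra.
Import Order.TTheory GRing.Theory Num.Theory.
Local Open Scope ring_scope.

(** Order the pairs as [a <= b] and [c <= d]; if [{c,d}] is the inner one, then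
    [a < c <= d < b].  By convexity of the [k]-th power, moving from [{a,b}]
    inwards by one step to [{a+1,b-1}] loses at least the second difference
    [(x+1)^k - 2 x^k + (x-1)^k >= k(k-1) x^(k-2)] at [x = b-1 >= S/2], and
    moving further inwards to [{c,d}] does not increase the sum of powers. *)

Section PowerDifferences.
Variable R : realFieldType.
Implicit Types x y t : R.

(** Convexity as monotone increments: [(x + t)^(k+1) - x^(k+1)] equals
    [x * ((x + t)^k - x^k) + t * (x + t)^k], and both terms grow with [x] by induction. *)
Lemma ler_exp_increment k x y t : 0 <= x -> x <= y -> 0 <= t ->
  (x + t) ^+ k + y ^+ k <= x ^+ k + (y + t) ^+ k.
Proof.
move=> x0 xy t0; elim: k => [|k IHk]; first by rewrite !expr0.
rewrite !exprS.
have y0 : 0 <= y by lra.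
have incr_le : t * (x + t) ^+ k <= t * (y + t) ^+ k.
  by rewrite ler_wpM2l // lerXn2r ?nnegrE; lra.
have ypow : y ^+ k <= (y + t) ^+ k by rewrite lerXn2r ?nnegrE; lra.
have : x * ((x + t) ^+ k - x ^+ k) <= y * ((y + t) ^+ k - y ^+ k).
  apply: (@le_trans _ _ (x * ((y + t) ^+ k - y ^+ k))).
    by rewrite ler_wpM2l //; lra.
  by rewrite ler_wpM2r // subr_ge0.
lra.
Qed.

(** Raising the exponent multiplies the difference by [x] and adds [(x + 1)^(k+1) + (x - 1)^(k+1)],
    which convexity bounds below by [2 * x^(k+1)]. *)
Lemma exp_central_difference_ge k x : 1 <= x ->
  2 * k.+1%:R * x ^+ k <= (x + 1) ^+ k.+1 - (x - 1) ^+ k.+1.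
Proof.
move=> x1; elim: k => [|k IHk]; first by rewrite expr0 !expr1; lra.
have conv : x ^+ k.+1 + x ^+ k.+1 <= (x - 1) ^+ k.+1 + (x + 1) ^+ k.+1.
  have := ler_exp_increment k.+1 (x - 1) x 1; rewrite subrK.
  by apply; lra.
have /(ler_wpM2l (_ : 0 <= x)) := IHk => /(_ ltac:(lra)) IHx.
have eL : 2 * k.+2%:R * x ^+ k.+1
          = x * (2 * k.+1%:R * x ^+ k) + 2 * x ^+ k.+1.
  by rewrite exprS -[k.+2]addn1 natrD; ring.
have eR : (x + 1) ^+ k.+2 - (x - 1) ^+ k.+2
          = x * ((x + 1) ^+ k.+1 - (x - 1) ^+ k.+1)
            + ((x + 1) ^+ k.+1 + (x - 1) ^+ k.+1).
  by rewrite !(exprS _ k.+1); ring.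
rewrite eL eR; lra.
Qed.

(** Same recursion: the new second difference is [x] times the old one plus a central difference,
    bounded by the previous lemma. *)
Lemma exp_second_difference_ge k x : 1 <= x ->
  k.+2%:R * k.+1%:R * x ^+ k
    <= (x + 1) ^+ k.+2 + (x - 1) ^+ k.+2 - 2 * x ^+ k.+2.
Proof.
move=> x1; elim: k => [|k IHk].
  by rewrite le_eqVlt; apply/orP; left; apply/eqP; ring.
have central := exp_central_difference_ge k.+1 x x1.
have /(ler_wpM2l (_ : 0 <= x)) := IHk => /(_ ltac:(lra)) IHx.
have eL : k.+3%:R * k.+2%:R * x ^+ k.+1
          = x * (k.+2%:R * k.+1%:R * x ^+ k) + 2 * k.+2%:R * x ^+ k.+1.
  by rewrite exprS -[k.+3]addn2 -[k.+2]addn1 !natrD; ring.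
have eR : (x + 1) ^+ k.+3 + (x - 1) ^+ k.+3 - 2 * x ^+ k.+3
          = x * ((x + 1) ^+ k.+2 + (x - 1) ^+ k.+2 - 2 * x ^+ k.+2)
            + ((x + 1) ^+ k.+2 - (x - 1) ^+ k.+2).
  by rewrite !(exprS _ k.+2); ring.
rewrite eL eR; lra.
Qed.

Lemma power_sum_gap k (a b c d : nat) :
  (a + b = c + d)%N -> (a < c)%N -> (c <= d)%N ->
  k.+2%:R * k.+1%:R * ((a + b) %/ 2)%N%:R ^+ k
    <= a%:R ^+ k.+2 + b%:R ^+ k.+2 - c%:R ^+ k.+2 - d%:R ^+ k.+2 :> R.
Proof.
move=> eS ac cd.
(* Here [m.+1] is [b - 1], the centre of the second difference, and [s] below is the common distance
   from [{a+1, b-1}] in to [{c, d}]. *)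
have [m eb] : exists m, b = m.+2 by exists b.-2; lia.
have {eS} [[s ec] em] : (exists s, c = a.+1 + s)%N /\ (a + m.+2 = c + d)%N.
  by split; [exists (c - a.+1)%N | ]; lia.
have ed : m.+1 = (d + s)%N by lia.
have am : (a%:R : R) <= m%:R by rewrite ler_nat; lia.
have m1 : (1 : R) <= m.+1%:R by rewrite ler1n.
have inner : c%:R ^+ k.+2 + d%:R ^+ k.+2
             <= a.+1%:R ^+ k.+2 + m.+1%:R ^+ k.+2 :> R.
  by rewrite ec ed !natrD; apply: ler_exp_increment; rewrite ?ler0n ?ler_nat //; lia.
(* Since [a <= m], the unit increment at [a] is at most the one at [m]; this turns the loss of the
   first step into a second difference at [m.+1]. *)
have outer : a.+1%:R ^+ k.+2 + m%:R ^+ k.+2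
             <= a%:R ^+ k.+2 + m.+1%:R ^+ k.+2 :> R.
  by rewrite -[a.+1]addn1 -[m.+1]addn1 !natrD; apply: ler_exp_increment;
     rewrite ?ler0n ?ler01.
have := exp_second_difference_ge k _ m1.
have -> : m.+1%:R + 1 = b%:R :> R by rewrite eb natr1.
have -> : m.+1%:R - 1 = m%:R :> R by rewrite -natr1 addrK.
have : k.+2%:R * k.+1%:R * ((a + b) %/ 2)%N%:R ^+ k
       <= k.+2%:R * k.+1%:R * m.+1%:R ^+ k :> R.
  by rewrite ler_wpM2l ?mulr_ge0 ?ler0n // lerXn2r ?nnegrE ?ler0n // ler_nat; lia.
lra.
Qed.

Lemma normr_power_sum_gap k (a b c d S : nat) :
  (a + b = S)%N -> (c + d = S)%N ->
  ~ (a = c /\ b = d) -> ~ (a = d /\ b = c) ->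
  k.+2%:R * k.+1%:R * (S %/ 2)%N%:R ^+ k
    <= `|a%:R ^+ k.+2 + b%:R ^+ k.+2 - c%:R ^+ k.+2 - d%:R ^+ k.+2| :> R.
Proof.
wlog ab : a b / (a <= b)%N.
  move=> H e1 e2 n1 n2; case/orP: (leq_total a b) => [?|ba]; first exact: H.
  by rewrite [a%:R ^+ _ + _]addrC; apply: H => //; lia.
wlog cd : c d / (c <= d)%N.
  move=> H e1 e2 n1 n2; case/orP: (leq_total c d) => [?|dc]; first exact: H.
  by rewrite addrAC; apply: H => //; lia.
(* Exchanging the two pairs only changes the sign inside the absolute value. *)
wlog ac : a b c d ab cd / (a <= c)%N.
  move=> H e1 e2 n1 n2; case/orP: (leq_total a c) => [?|ca]; first exact: H.
  rewrite -normrN.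
  have -> : - (a%:R ^+ k.+2 + b%:R ^+ k.+2 - c%:R ^+ k.+2 - d%:R ^+ k.+2)
            = c%:R ^+ k.+2 + d%:R ^+ k.+2 - a%:R ^+ k.+2 - b%:R ^+ k.+2 :> R.
    by ring.
  by apply: H => //; lia.
(* The inequality [a <= c] is strict, since [a = c] would force [b = d]. *)
move=> e1 e2 n1 n2; apply: le_trans (ler_norm _).
by rewrite -e1; apply: power_sum_gap; lia.
Qed.

End PowerDifferences.

Theorem theorem2p6 (k a b c d S : nat)
    (hk : (2 <= k)%N) (hab : (a + b)%N = S) (hcd : (c + d)%N = S)
    (hS : (2 <= S)%N) (hne : [fset a; b]%fset <> [fset c; d]%fset) :
  `|a%:R ^+ k + b%:R ^+ k - c%:R ^+ k - d%:R ^+ k : rat|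
    >= k%:R * (k%:R - 1) * (S %/ 2)%N%:R ^+ (k - 2)
  /\ (k%:R * (k%:R - 1) * (S %/ 2)%N%:R ^+ (k - 2) : rat)
    >= C_ k * S%:R ^+ (k - 2).
Proof.
case: k hk => [|[|k]] // _; rewrite /C_ subn2 /=.
have -> : k.+2%:R - 1 = k.+1%:R :> rat by rewrite -natr1 addrK.
split.
  apply: normr_power_sum_gap => // -[e1 e2]; apply: hne; rewrite e1 e2 //.
  exact: fsetUC.
have -> : 2%:Z - k.+2%:Z = - k%:Z by lia.
rewrite -[X in X <= _]mulrA ler_wpM2l ?mulr_ge0 ?ler0n //.
(* The powers combine into [(S/3)^k], so it remains to see [S <= 3 * (S %/ 2)], which holds for
   [S >= 2] with equality at [S = 3]. *)
rewrite -exprz_inv -exprnP -exprMn lerXn2r ?nnegrE ?mulr_ge0 ?invr_ge0 ?ler0n //.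
by rewrite ler_pdivrMl ?ltr0n // -natrM ler_nat; lia.
Qed.
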